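(* Let $G$ be a finite group acting on a sandpile graph $\Gamma=(V,E,\mathrm{wt},s)$, and let $\mathcal{S}(\Gamma)^G$ be the set of symmetric recurrent configurations on $\Gamma$ and $\widetilde\Delta^G$ the symmetrized reduced Laplacian. Then the number of symmetric recurrent configurations is $$|\mathcal{S}(\Gamma)^G|=\det\widetilde\Delta^G.$$
   Context: Sandpile graph: $\Gamma=(V,E,\mathrm{wt},s)$ is a finite directed graph with edge-weight function $\mathrm{wt}\colon V\times V\to\mathbb{N}=\{0,1,2,\dots\}$, $\mathrm{wt}(v,w)>0$ iff $(v,w)\in E$, and a vertex $s$ (the sink) such that every vertex has a directed path to $s$. Let $\widetilde V=V\setminus\{s\}$ and $\mathrm{outdeg}(v)=\sum_{w\in V}\mathrm{wt}(v,w)$. Configurations: a configuration is an element $c=\sum_{v\in\widetilde V}c_v v\in\mathbb{N}\widetilde V$. A vertex $v\in\widetilde V$ is unstable in $c$ if $c_v\ge\mathrm{outdeg}(v)$; firing it replaces $c$ by $c-\mathrm{outdeg}(v)v+\sum_{w\in\widetilde V}\mathrm{wt}(v,w)w$. Repeatedly firing unstable vertices leads in finitely many steps to a stable configuration (no unstable vertices) $c^\circ$, independent of the choices made. A configuration $c$ is recurrent if it is stable and for every configuration $a$ there is a configuration $b$ with $(a+b)^\circ=c$. Action: an action of $G$ on $\Gamma$ is an action of $G$ on the set $V$ with $gs=s$ for all $g\in G$ and such that $(v,w)\in E$ implies $(gv,gw)\in E$ with both edges having the same weight. It extends linearly to configurations. A configuration $c$ is symmetric if $gc=c$ for all $g\in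 G$. Symmetrized reduced Laplacian: the reduced Laplacian is $\widetilde\Delta\colon\mathbb{Z}\widetilde V\to\mathbb{Z}\widetilde V$, $\widetilde\Delta(v)=\mathrm{outdeg}(v)v-\sum_{w\in\widetilde V}\mathrm{wt}(v,w)w$. Let $\mathcal{O}=\{Gv:v\in\widetilde V\}$ be the set of orbits of non-sink vertices. Then $\widetilde\Delta^G\colon\mathbb{Z}\mathcal{O}\to\mathbb{Z}\mathcal{O}$ is the $\mathbb{Z}$-linear map such that for all $v,w\in\widetilde V$ the $Gw$-th component of $\widetilde\Delta^G(Gv)$ is the $w$-th component of $\sum_{u\in Gv}\widetilde\Delta(u)$ (independent of the choice of representative $w$). *)

(* Defs.v *)
From HB Require Import structures.
From mathcomp Require Import all_boot all_order all_algebra all_fingroup.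
From mathcomp Require Import finmap.
From mathcomp Require Import boolp classical_sets cardinality.

Set Implicit Arguments.
Unset Strict Implicit.
Unset Printing Implicit Defensive.

Import GRing.Theory.

(* The edge set is E = {(v, w) | 0 < wt v w}; loops are allowed. *)
Record sandpile_graph : Type := SandpileGraph {
  vertex :> finType;
  wt : vertex -> vertex -> nat;
  sink : vertex;
  connect_sink : forall v : vertex,
    connect [rel x y : vertex | 0 < wt x y] v sink
}.

Arguments wt {s} _ _.
Arguments sink {s}.

Definition edge (Gam : sandpile_graph) : rel Gam := [rel v w | 0 < wt v w].

Definition outdeg (Gam : sandpile_graph) (v : Gam) : nat :=
  \sum_(w : Gam) wt v w.

Notation nonsink Gam := {v : vertex Gam | v != sink}.
Notation config Gam := {ffun nonsink Gam -> nat}.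

Section Configurations.
Variable Gam : sandpile_graph.
Implicit Types (a b c d : config Gam) (v w : nonsink Gam).

Definition unstable c v : bool := outdeg (val v) <= c v.

Definition stable c : Prop := forall v, ~~ unstable c v.

(* The truncated subtraction is exact when v is unstable in c, the only case
   in which [fire] is used. *)
Definition fire c v : config Gam :=
  [ffun w => c w - (if w == v then outdeg (val v) else 0)
             + wt (val v) (val w)].

Inductive firing_sequence : config Gam -> config Gam -> Prop :=
| firing_nil c : firing_sequence c c
| firing_cons c v d :
    unstable c v -> firing_sequence (fire c v) d -> firing_sequence c d.

(* The graph of the stabilization map: d is the configuration written c^o. *)
Definition stabilizes_to c d : Prop := firing_sequence c d /\ stable d.

Definition recurrent c : Prop :=
  stable c /\ forall a, exists b, stabilizes_to (a + b)%R c.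

Local Open Scope ring_scope.

(* The image of the basis vector v under the reduced Laplacian. *)
Definition reduced_laplacian v : {ffun nonsink Gam -> int} :=
  [ffun w => (if w == v then (outdeg (val v))%:Z else 0)
             - (wt (val v) (val w))%:Z].

End Configurations.

Section Symmetry.
Variables (Gam : sandpile_graph) (gT : finGroupType) (G : {group gT}).
Variable to : action G Gam.
Implicit Types (c : config Gam) (v w : nonsink Gam) (g : gT).

(* [to] is a right action; a left action corresponds to it through
   gv := to v g^-1, which changes neither the orbits nor the fixed points. *)
Definition sandpile_action : Prop :=
  (forall g, g \in G -> to sink g = sink) /\
  (forall g (v w : Gam), g \in G -> edge v w ->
     edge (to v g) (to w g) /\ wt (to v g) (to w g) = wt v w).

(* Linear extension of the action on vertices: the coefficient of w in the
   formal sum of the c_v (to v g). *)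
Definition act_config c g : config Gam :=
  [ffun w => \sum_(v : nonsink Gam | to (val v) g == val w) c v].

Definition symmetric_config c : Prop :=
  forall g, g \in G -> act_config c g = c.

Definition symmetric_recurrent : set (config Gam) :=
  [set c | recurrent c /\ symmetric_config c]%classic.

Definition nonsink_orbit v : {set nonsink Gam} :=
  [set w | val w \in orbit to G (val v)].

Definition orbits : {set {set nonsink Gam}} :=
  [set nonsink_orbit v | v : nonsink Gam].

Definition orbit_at (i : 'I_#|orbits|) : {set nonsink Gam} := enum_val i.

Lemma orbit_rep_subproof (i : 'I_#|orbits|) :
  exists v, orbit_at i == nonsink_orbit v.
Proof. by have /imsetP[v _ Ev] := enum_valP i; exists v; apply/eqP. Qed.

Definition orbit_rep (i : 'I_#|orbits|) : nonsink Gam :=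
  xchoose (orbit_rep_subproof i).

Local Open Scope ring_scope.

(* The matrix, in the basis of orbits, of the symmetrized reduced Laplacian:
   column j holds the components of the image of the j-th orbit.  The choice
   of representative is irrelevant, see [sym_laplacianE]. *)
Definition sym_laplacian : 'M[int]_#|orbits| :=
  \matrix_(i, j)
    (\sum_(u in orbit_at j) reduced_laplacian u) (orbit_rep i).

Hypothesis Hact : sandpile_action.

Let actK g : g \in G -> cancel (to^~ g) (to^~ (g^-1)%g).
Proof. by move=> gG x; exact: actKin. Qed.

Let actKV g : g \in G -> cancel (to^~ (g^-1)%g) (to^~ g).
Proof. by move=> gG x; exact: actKVin. Qed.

Lemma wt_act g (x y : Gam) : g \in G -> wt (to x g) (to y g) = wt x y.
Proof.
move=> gG; have [_ E] := Hact.
case: (posnP (wt x y)) => [xy0|xy]; last by have [] := E g x y gG xy.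
case: (posnP (wt (to x g) (to y g))) => [->//|xy].
have [_] := E _ _ _ (groupVr gG) xy.
by rewrite !actK // xy0 => <-.
Qed.

Lemma outdeg_act g (x : Gam) : g \in G -> outdeg (to x g) = outdeg x.
Proof.
move=> gG; rewrite /outdeg (reindex (to^~ g)) /=.
  by apply: eq_bigr => y _; rewrite wt_act.
exists (to^~ (g^-1)%g) => y _; [exact: actK|exact: actKV].
Qed.

Lemma nonsink_act g (x : Gam) : g \in G -> (to x g != sink) = (x != sink).
Proof.
move=> gG; have [S _] := Hact.
by rewrite -(inj_eq (can_inj (actK gG)) x sink) S.
Qed.

Lemma sym_laplacianE i j v w :
    orbit_at j = nonsink_orbit v -> orbit_at i = nonsink_orbit w ->
  sym_laplacian i j = (\sum_(u in nonsink_orbit v) reduced_laplacian u) w.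
Proof.
move=> Ej Ei; rewrite mxE Ej !sum_ffunE.
have /eqP Er := xchooseP (orbit_rep_subproof i).
have: orbit_rep i \in nonsink_orbit w.
  by rewrite -Ei Er inE orbit_refl.
rewrite inE => /imsetP[g gG Eg].
pose h (k : gT) (u : nonsink Gam) := insubd u (to (val u) k).
have hE k u : k \in G -> val (h k u) = to (val u) k.
  by move=> kG; rewrite val_insubd nonsink_act // (valP u).
have hK : cancel (h g) (h g^-1%g).
  by move=> u; apply: val_inj; rewrite !hE ?groupV // actK.
have hKV : cancel (h g^-1%g) (h g).
  by move=> u; apply: val_inj; rewrite !hE ?groupV // actKV.
rewrite (reindex (h g)) /=; last by exists (h g^-1%g) => u _.
apply: eq_big => [u|u _].
  rewrite !inE hE //; apply/imsetP/imsetP => -[k kG].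
    move=> E; exists (k * g^-1)%g; first by rewrite groupM ?groupV.
    by rewrite actMin ?groupV // -E actK.
  by move=> ->; exists (k * g)%g; rewrite ?groupM // actMin.
have -> : orbit_rep i = h g w by apply: val_inj; rewrite hE.
by rewrite !ffunE !hE // wt_act // outdeg_act // (inj_eq (can_inj hK)).
Qed.

End Symmetry.

(* Main.v *)
Require Import Defs.
From HB Require Import structures.
From mathcomp Require Import all_boot all_order all_algebra all_fingroup.
From mathcomp Require Import finmap.
From mathcomp Require Import boolp classical_sets cardinality.
From mathcomp Require Import zify lra.

(* Symmetric configurations are integer vectors indexed by the orbits, and the
   matrix A of the symmetrized reduced Laplacian is a Z-matrix with
   A x >= 0 -> x >= 0 (a nonsingular M-matrix), so \det A > 0.  For such an A
   and any bound b, each coset v + A Z^n contains exactly one "saturated" c: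
   c <= b, and c + A y <= b with y >= 0 only for y = 0.  It comes from the
   largest x with v + A x <= b.  Hence there are |Z^n / A Z^n| = \det A of them.
   For the ordinary reduced Laplacian and the maximal stable configuration b,
   saturated means recurrent, by the least action principle; for a symmetric c,
   replacing y by its maximum over each orbit shows that it is enough to test
   symmetric y. *)

Set Implicit Arguments.
Unset Strict Implicit.
Unset Printing Implicit Defensive.

Import Order.TTheory GRing.Theory Num.Theory.

Local Open Scope ring_scope.

(** * Monotone Z-matrices over the integers *)

Definition nonneg_cv n (x : 'cV[int]_n) := forall i, 0 <= x i 0.
Definition Zmatrix n (A : 'M[int]_n) := forall i j, i != j -> A i j <= 0.
Definition monotone_mx n (A : 'M[int]_n) :=
  forall x : 'cV_n, nonneg_cv (A *m x) -> nonneg_cv x.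

(** If [A i i <= 0], the whole column [i] is nonpositive, so [A] sends minus the [i]-th basis vector
    to a nonnegative vector, against monotonicity. *)
Lemma Zmonotone_diag_gt0 n (A : 'M[int]_n) i :
  Zmatrix A -> monotone_mx A -> 0 < A i i.
Proof.
move=> ZA mA; rewrite ltNge; apply/negP => Aii.
have /mA/(_ i) : nonneg_cv (A *m - delta_mx i (0 : 'I_1)).
  move=> k; rewrite mulmxN -colE !mxE oppr_ge0.
  by have [->//|ki] := eqVneq k i; exact: ZA.
by rewrite !mxE !eqxx.
Qed.

(* Division-free Schur complement: for a := A 0 0, the matrix a *: A' - c *m r
   is again a monotone Z-matrix and its determinant has the sign of \det A. *)
Lemma Zmonotone_det_gt0 n (A : 'M[int]_n) :
  Zmatrix A -> monotone_mx A -> 0 < \det A.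
Proof.
elim: n A => [|n IHn] A ZA mA; first by rewrite det_mx00.
have a_gt0 := Zmonotone_diag_gt0 0 ZA mA.
pose B : 'M_(1 + n) := A.
pose a := A 0 0; pose r := ursubmx B; pose c := dlsubmx B; pose D := drsubmx B.
have ulE : ulsubmx B = a%:M.
  by rewrite [LHS]mx11_scalar /a !mxE; congr (A _ _)%:M; apply: val_inj.
have BE : B = block_mx a%:M r c D by rewrite -ulE submxK.
pose S := a *: D - c *m r.
have SE : block_mx 1%:M 0 (- c) a%:M *m B = block_mx a%:M r 0 S.
  rewrite BE mulmx_block !mul1mx !mul0mx !addr0 !mul_scalar_mx mulNmx.
  by rewrite mul_mx_scalar addNr addrC mulNmx.
have detE : a ^+ n * \det A = a * \det S.
  move: (congr1 determinant SE).
  by rewrite det_mulmx det_lblock det_ublock det1 !det_scalar mul1r expr1.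
have rE j : r 0 j = A 0 (lift 0 j).
  by rewrite !mxE; congr (A _ _); apply: val_inj.
have cE i : c i 0 = A (lift 0 i) 0.
  by rewrite !mxE; congr (A _ _); apply: val_inj.
have DE i j : D i j = A (lift 0 i) (lift 0 j).
  by rewrite !mxE; congr (A _ _); apply: val_inj.
have SijE i j : S i j = a * A (lift 0 i) (lift 0 j)
                        - A (lift 0 i) 0 * A 0 (lift 0 j).
  rewrite -DE -rE -cE /S; move: (D) (r) (c) => D' r' c'.
  by rewrite !mxE big_ord1.
have S_gt0 : 0 < \det S.
  apply: IHn => [i j ij|x Sx].
    rewrite SijE.
    have a0 : 0 <= a by exact: ltW.
    have h1 : A (lift 0 i) (lift 0 j) <= 0.
      by apply: ZA; rewrite (inj_eq (@lift_inj _ _)).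
    have h2 : A (lift 0 i) 0 <= 0 by exact: ZA.
    have h3 : A 0 (lift 0 j) <= 0 by exact: ZA.
    by nia.
  (* The head [- (r *m x)] cancels the upper block of [B *m z]; scaling the tail by [a] avoids a
     division. *)
  pose z : 'cV_(1 + n) := col_mx (- (r *m x)) (a *: x).
  have zE : B *m z = col_mx 0 (S *m x).
    rewrite BE /z mul_block_col mul_scalar_mx -scalemxAr scalerN addNr.
    by rewrite mulmxN mulmxA -scalemxAr scalemxAl -mulNmx -mulmxDl addrC.
  have z0 : nonneg_cv z.
    apply: mA; rewrite -[A]/B zE => i.
    by rewrite mxE; case: split => k //; rewrite mxE.
  move=> i; have := z0 (rshift 1 i); rewrite /z col_mxEd mxE.
  by rewrite pmulr_rge0.
by rewrite -(pmulr_rgt0 _ (exprn_gt0 n a_gt0)) detE mulr_gt0.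
Qed.

(** The adjugate replaces the inverse: it yields an integral [h] with [A *m h = \det A *: b'], where
    [b'] is the entrywise absolute value of [b] and [\det A] is at least 1. *)
Lemma Zmonotone_dominate n (A : 'M[int]_n) (b : 'cV_n) :
    Zmatrix A -> monotone_mx A ->
  exists2 h, nonneg_cv h & nonneg_cv (A *m h - b).
Proof.
move=> ZA mA; have dA := Zmonotone_det_gt0 ZA mA.
pose b' : 'cV_n := map_mx Num.norm b.
have hE : A *m (\adj A *m b') = \det A *: b'.
  by rewrite mulmxA mul_mx_adj mul_scalar_mx.
exists (\adj A *m b').
  by apply: mA => i; rewrite hE !mxE mulr_ge0 // ltW.
move=> i; rewrite mxE hE !mxE subr_ge0 (le_trans (ler_norm _)) //.
by rewrite ler_peMl //; lia.
Qed.

(** In Smith form [A = L D R], the coset of [v] is determined by the coordinates of [invmx L *m v]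
    modulo the diagonal entries of [D]. The representatives are [L *m t] for [t] in the box of
    remainders. *)
Lemma int_coset_transversal n (A : 'M[int]_n) : \det A != 0 ->
  exists (T : finType) (r : T -> 'cV[int]_n),
    [/\ #|T| = `|\det A|%N,
        forall v, exists t x, v = r t + A *m x &
        forall t t' x, r t = r t' + A *m x -> t = t'].
Proof.
have [L uL [R uR [d _ AE]]] := int_Smith_normal_form A.
pose e (i : 'I_n) : int := d`_i.
pose D : 'M[int]_n := \matrix_(i, j) (e i *+ (i == j :> nat)).
have abs_unit (M : 'M[int]_n) : M \in unitmx -> `|\det M|%N = 1%N.
  by rewrite unitmxE => /orP[] /eqP ->.
have DE (x : 'cV_n) i : (D *m x) i 0 = e i * x i 0.
  rewrite mxE (bigD1 i) //= big1 ?addr0 => [|j ji]; first by rewrite mxE eqxx.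
  by rewrite mxE eq_sym val_eqE (negPf ji) mul0r.
have detD : `|\det A|%N = (\prod_(i < n) `|e i|)%N.
  rewrite AE !det_mulmx !abszM (abs_unit L) ?(abs_unit R) // mul1n muln1.
  rewrite det_trig; last first.
    by apply/is_trig_mxP => i j ij; rewrite mxE ltn_eqF.
  rewrite (big_morph absz abszM (erefl : `|1 : int|%N = 1%N)).
  by apply: eq_bigr => i _; rewrite mxE eqxx.
rewrite -absz_eq0 detD => d0.
have {}d0 (i : 'I_n) : e i != 0.
  apply: contraNneq d0 => di0; apply/eqP.
  by rewrite (bigD1 i) //= di0 mul0n.
pose T : finType := {dffun forall i : 'I_n, 'I_`|e i|%N}; exists T.
exists (fun t : T => L *m \col_i (t i : nat)%:Z); split.
- rewrite card_dep_ffun foldrE big_map big_enum.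
  by apply: eq_bigr => i _; rewrite card_ord.
- move=> v; pose w := invmx L *m v.
  have lt i : (`|(w i 0%R %% e i)%Z| < `|e i|)%N.
    by have := ltz_mod (w i 0%R) (d0 i); have := modz_ge0 (w i 0%R) (d0 i); lia.
  exists [ffun i => Ordinal (lt i)].
  exists (invmx R *m \col_(i < n) (w i 0%R %/ e i)%Z).
  rewrite AE -mulmxA mulKVmx // -mulmxA -mulmxDr.
  rewrite -[LHS](mulKVmx uL) -/w; congr (_ *m _); clearbody w.
  apply/colP => i.
  rewrite [RHS]mxE -/D DE !mxE ffunE /= gez0_abs ?modz_ge0 //.
  by rewrite addrC mulrC -divz_eq.
move=> t t' x; rewrite AE -!mulmxA -mulmxDr => /(can_inj (mulKmx uL)) E.
apply/ffunP => i; apply: val_inj => /=.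
have := congr1 (fun M : 'cV_n => M i 0) E.
rewrite [in X in _ = X -> _]mxE -/D DE !mxE.
set q := (\sum_j _) => Et.
have := ltn_ord (t i); have := ltn_ord (t' i).
move: (d0 i) Et; set di := e i => dn0 Et lt' lt.
(* [di * q] is a difference of two remainders in [[0, |di|)], so [q] vanishes. *)
suff q0 : q = 0 by move: Et; rewrite q0 mulr0 addr0 => -[].
have : `|di| * `|q| < `|di|.
  by rewrite -normrM; lia.
by nia.
Qed.

(** * Saturated representatives of cosets *)

(* For A the reduced Laplacian and b the maximal stable configuration, these
   are the complements in b of the superstable configurations. *)
Definition saturated n (A : 'M[int]_n) (b c : 'cV[int]_n) :=
  nonneg_cv (b - c) /\
  forall y, nonneg_cv y -> nonneg_cv (b - (c + A *m y)) -> y = 0.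

Lemma saturated_exists n (A : 'M[int]_n) (b v : 'cV_n) :
  Zmatrix A -> monotone_mx A -> exists x, saturated A b (v + A *m x).
Proof.
move=> ZA mA.
have [h _ hb] := Zmonotone_dominate (b - v) ZA mA.
have [k _ kb] := Zmonotone_dominate (v - b) ZA mA.
have le_h x : nonneg_cv (b - (v + A *m x)) -> nonneg_cv (h - x).
  move=> Hx; apply: mA => i; rewrite mulmxBr.
  have := hb i; have := Hx i; move: (A *m h) (A *m x) => Ah Ax.
  by rewrite !mxE; lra.
(* Induction on a bound [m] for the total gap between [x] and its upper bound [h]: a failure of
   saturation supplies a nonzero [y >= 0] with [x + y] still feasible and closer to [h]. The start
   [- k] is feasible by the choice of [k]. *)
suff H m x : nonneg_cv (b - (v + A *m x)) -> \sum_i (h - x) i 0 < m%:Z ->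
    exists x, saturated A b (v + A *m x).
  pose s := \sum_i (h + k) i 0; apply: (H `|s|.+1%N (- k)).
    move=> i; rewrite mulmxN; have := kb i; move: (A *m k) => Ak.
    by rewrite !mxE; lra.
  by rewrite opprK -/s; lia.
elim: m x => [|m IHm] x fx sx.
  by move: sx; rewrite ltNge sumr_ge0 // => i _; exact: le_h.
have [sat|] := pselect (saturated A b (v + A *m x)); first by exists x.
move=> /not_andP[//|/existsNP[y /not_implyP[y0 /not_implyP[fy /eqP yn0]]]].
apply: (IHm (x + y)); first by rewrite mulmxDr addrA.
have -> : \sum_i (h - (x + y)) i 0 = \sum_i (h - x) i 0 - \sum_i y i 0.
  by rewrite -sumrB; apply: eq_bigr => i _; rewrite !mxE opprD addrA.
suff : 0 < \sum_i y i 0 by lia.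
rewrite lt_neqAle sumr_ge0 ?andbT => [|i _]; last exact: y0.
apply: contraNneq yn0 => /esym/eqP; rewrite psumr_eq0 => [/allP s0|i _ //].
by apply/eqP/colP => i; rewrite mxE; apply/eqP/s0; exact: mem_index_enum.
Qed.

(* The feasible points {y | c + A y <= b} of a Z-matrix are closed under
   pointwise maximum. *)
Lemma saturated_unique n (A : 'M[int]_n) (b c z : 'cV_n) : Zmatrix A ->
  saturated A b c -> saturated A b (c + A *m z) -> z = 0.
Proof.
move=> ZA.
(* Nonpositivity of feasible points suffices: it is applied to [z] from [c], and to [- z] from
   [c + A *m z]. *)
suff H c1 z1 : saturated A b c1 -> nonneg_cv (b - (c1 + A *m z1)) ->
    nonneg_cv (- z1).
  move=> s1 s2; have h1 := H _ _ s1 s2.1.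
  have := H _ (- z) s2; rewrite mulmxN addrK opprK => /(_ s1.1) h2.
  by apply/colP => i; have := h1 i; have := h2 i; rewrite !mxE; lra.
move=> [f0 s1] f1 {c z}.
pose y : 'cV_n := \col_i Num.max 0 (z1 i 0).
have y0 : y = 0.
  apply: s1 => [i|i]; first by rewrite mxE le_max lexx.
  (* Row [i] is nonpositive off the diagonal, so raising the other coordinates can only lower the
     [i]-th entry. At each [i], [y] agrees with [z1] or with 0. *)
  have le_Ay (x : 'cV_n) : nonneg_cv (y - x) -> y i 0 = x i 0 ->
      (A *m y) i 0 <= (A *m x) i 0.
    move=> yx yi; rewrite !mxE ler_sum // => j _.
    have [<-|ij] := eqVneq i j; first by rewrite yi.
    have := yx j; rewrite !mxE subr_ge0 => ?.
    by rewrite ler_wnM2l // ZA.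
  have [zi|zi] := leP 0 (z1 i 0).
    have : (A *m y) i 0 <= (A *m z1) i 0.
      apply: le_Ay => [k|]; last by rewrite mxE max_r.
      by rewrite !mxE subr_ge0 le_max lexx orbT.
    have := f1 i; move: (A *m y) (A *m z1) => Ay Az.
    by rewrite !mxE; lra.
  have : (A *m y) i 0 <= (A *m (0 : 'cV_n)) i 0.
    apply: (le_Ay 0) => [k|]; last by rewrite !mxE max_l // ltW.
    by rewrite !mxE subr0 le_max lexx.
  have := f0 i; move: (A *m y) => Ay.
  by rewrite mulmx0 !mxE; lra.
move=> i; have := congr1 (fun M : 'cV_n => M i 0) y0; rewrite !mxE => M0.
by rewrite oppr_ge0 -M0 le_max lexx orbT.
Qed.

Lemma card_saturated n (A : 'M[int]_n) (b : 'cV_n) :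
    Zmatrix A -> monotone_mx A ->
  exists (T : finType) (r : T -> 'cV[int]_n),
    [/\ #|T|%:Z = \det A, injective r, forall t, saturated A b (r t) &
        forall c, saturated A b c -> exists t, c = r t].
Proof.
move=> ZA mA; have dA := Zmonotone_det_gt0 ZA mA.
have [T [r [cardT r_surj r_inj]]] := int_coset_transversal (lt0r_neq0 dA).
pose s t := projT1 (cid (saturated_exists b (r t) ZA mA)).
have sP t : saturated A b (r t + A *m s t).
  exact: projT2 (cid (saturated_exists b (r t) ZA mA)).
exists T, (fun t => r t + A *m s t); split=> //.
- by rewrite cardT abszE gtr0_norm.
- move=> t t' E; apply: (r_inj _ _ (s t' - s t)).
  by rewrite mulmxBr addrA -E addrK.
move=> c sc; have [t [x cE]] := r_surj c; exists t.
have := sP t; have -> : r t + A *m s t = c + A *m (s t - x).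
  by rewrite cE mulmxBr -addrA [A *m x + _]addrC subrK.
by move/(saturated_unique ZA sc) ->; rewrite mulmx0 addr0.
Qed.

(** If [c i 0 < 0], the [i]-th basis vector could be added as [y] without exceeding [b]. Hence
    saturated vectors can be read as configurations. *)
Lemma saturated_ge0 n (A : 'M[int]_n) (b c : 'cV_n) : Zmatrix A ->
  (forall i, A i i <= b i 0 + 1) -> saturated A b c -> nonneg_cv c.
Proof.
move=> ZA Ab [cb cr] i; rewrite leNgt; apply/negP => ci.
have /colP/(_ i) : delta_mx i (0 : 'I_1) = 0 :> 'cV[int]_n.
  apply: cr => k; first by rewrite mxE; case: (_ && _).
  rewrite -colE !mxE; have := cb k; rewrite !mxE.
  have {}ci : c i 0 <= - 1 by lia.
  have [->|ki] := eqVneq k i; first by have := Ab i; lra.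
  by have := ZA _ _ ki; lra.
by rewrite !mxE !eqxx.
Qed.

(** * Recurrent configurations *)

Section Sandpile.
Variable Gam : sandpile_graph.
Implicit Types (v w : nonsink Gam) (f g h : nonsink Gam -> int).
Implicit Types a b c d : config Gam.

(** The net loss of chips at [w] when each [v] fires [f v] times; negative counts are allowed. *)
Definition lap f w : int := \sum_v f v * reduced_laplacian v w.

Lemma lapD f g w : lap (f \+ g) w = lap f w + lap g w.
Proof. by rewrite -big_split; apply: eq_bigr => v _; rewrite /= mulrDl. Qed.

Lemma lapB f g w : lap (f \- g) w = lap f w - lap g w.
Proof. by rewrite -sumrB; apply: eq_bigr => v _; rewrite /= mulrBl. Qed.

Lemma lap0 f w : (forall v, f v = 0) -> lap f w = 0.
Proof. by move=> f0; rewrite /lap big1 // => v _; rewrite f0 mul0r. Qed.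

Definition single v w : int := (w == v)%:Z.

Lemma lap_single v w : lap (single v) w = reduced_laplacian v w.
Proof.
rewrite /lap (bigD1 v) //= big1 => [|u uv]; last first.
  by rewrite /single (negPf uv) mul0r.
by rewrite /single eqxx mul1r addr0.
Qed.

Lemma sub_single_ge0 h v : (forall w, 0 <= h w) -> 0 < h v ->
  forall w, 0 <= (h \- single v) w.
Proof.
move=> h0 hv w; rewrite /= /single; have := h0 w.
by case: eqP => [->|_]; lia.
Qed.

Lemma reduced_laplacian_le0 v w : w != v -> reduced_laplacian v w <= 0.
Proof. by move=> wv; rewrite ffunE (negPf wv) sub0r oppr_le0. Qed.

Lemma lap_le0 h v : (forall w, 0 <= h w) -> h v = 0 -> lap h v <= 0.
Proof.
move=> h0 hv0; rewrite /lap sumr_le0 // => w _.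
have [->|wv] := eqVneq w v; first by rewrite hv0 mul0r.
by rewrite mulr_ge0_le0 // reduced_laplacian_le0 // eq_sym.
Qed.

(** Sum [lap f] over the set [S] where [f < 0]. The coefficient [rowS v] of [f v] is the weight
    leaving [S] if [v] lies in [S], and is nonpositive otherwise, so every term is nonpositive and
    must vanish. Then no edge leaves [S], although [S] has a path to the sink. *)
Lemma lap_monotone f : (forall w, 0 <= lap f w) -> forall w, 0 <= f w.
Proof.
move=> lf0 w0; rewrite leNgt; apply/negP => fw0.
pose S := [set w | f w < 0].
pose rowS v := \sum_(w in S) reduced_laplacian v w.
have rowSE v : v \in S ->
    rowS v = (\sum_(y | y \notin val @: S) wt (val v) y)%N%:Z.
  move=> vS; pose diag w := if w == v then (outdeg (val v))%:Z else 0.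
  have -> : rowS v = \sum_(w in S) (diag w - (wt (val v) (val w))%:Z).
    by apply: eq_bigr => w _; rewrite ffunE.
  rewrite sumrB -big_mkcondr /= (big_pred1 v) => [|w]; last first.
    by rewrite /= andbC; case: eqP => // ->.
  rewrite /outdeg (bigID (mem (val @: S))) /= big_imset /=; last first.
    by move=> ? ? _ _; exact: val_inj.
  by rewrite -(big_morph Posz PoszD (erefl 0%:Z)) PoszD addrC addKr.
have terms0 v : 0 <= - (f v * rowS v).
  have [vS|vS] := boolP (v \in S).
    by move: (vS); rewrite rowSE // inE => fv; nia.
  have : 0 <= f v by move: vS; rewrite inE -leNgt.
  have : rowS v <= 0.
    apply: sumr_le0 => w wS; apply: reduced_laplacian_le0.
    by apply: contraNneq vS => <-.
  by nia.
have sum0 : \sum_v - (f v * rowS v) = 0.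
  apply: le_anti; rewrite sumr_ge0 ?andbT // sumrN oppr_le0.
  rewrite [X in 0 <= X](_ : _ = \sum_(w in S) lap f w).
    by apply: sumr_ge0.
  under eq_bigr do rewrite mulr_sumr.
  by rewrite exchange_big; apply: eq_bigr.
have closed (x y : Gam) :
    x \in val @: S -> (0 < wt x y)%N -> y \in val @: S.
  move=> /imsetP[v vS ->]; apply: contraLR => yS.
  have : - (f v * rowS v) == 0.
    move/eqP: sum0; rewrite psumr_eq0 // => /allP; apply.
    exact: mem_index_enum.
  rewrite oppr_eq0 mulf_eq0 lt_eqF; last by move: vS; rewrite inE.
  rewrite rowSE //= eqz_nat sum_nat_eq0 => /forallP/(_ y).
  by rewrite yS -eqn0Ngt.
have /connectP[p + psink] := connect_sink (val w0).
have : val w0 \in val @: S by rewrite imset_f // inE.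
elim: p (val w0) psink => [|y p IHp] x /= psink xS.
  by case/imsetP: xS => w _ E; have /eqP[] := valP w; exact: etrans (esym E) _.
by case/andP=> /(closed _ _ xS) yS; exact: IHp.
Qed.

Lemma lap_dominate (K : nat) :
  exists2 h : nonsink Gam -> int, (forall w, 0 <= h w) &
    forall w, K%:Z <= lap h w.
Proof.
pose A : 'M[int]_#|{: nonsink Gam}| :=
  \matrix_(i, j) reduced_laplacian (enum_val j) (enum_val i).
have AE (x : 'cV_#|{: nonsink Gam}|) i :
    (A *m x) i 0 = lap (fun v => x (enum_rank v) 0) (enum_val i).
  rewrite mxE /lap (reindex (@enum_rank _)) /=; last first.
    exact/onW_bij/enum_rank_bij.
  by apply: eq_bigr => v _; rewrite mxE enum_rankK mulrC.
have ZA : Zmatrix A.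
  move=> i j ij; rewrite mxE reduced_laplacian_le0 //.
  by rewrite (inj_eq enum_val_inj).
have mA : monotone_mx A.
  move=> x Ax i; rewrite -[i]enum_valK.
  apply: (@lap_monotone (fun v => x (enum_rank v) 0) _ (enum_val i)) => w.
  by rewrite -(enum_rankK w) -AE; exact: Ax.
have [x x0 Kx] := Zmonotone_dominate (const_mx K%:Z) ZA mA.
exists (fun v => x (enum_rank v) 0) => w //.
have := Kx (enum_rank w); rewrite mxE AE enum_rankK.
by rewrite !mxE subr_ge0.
Qed.

(** * Legal firing sequences and recurrence *)

Lemma fireE c v w : unstable c v ->
  (fire c v w)%:Z = (c w)%:Z - reduced_laplacian v w.
Proof.
by rewrite /unstable !ffunE => ucv; case: eqP => [->|_]; lia.
Qed.

(* Least action principle: a legal firing sequence fires no vertex more often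
   than any nonnegative firing vector that stabilizes c. *)
Lemma firing_sequence_least c d : firing_sequence c d ->
  exists g, [/\ forall v, 0 <= g v, forall w, (d w)%:Z = (c w)%:Z - lap g w &
    forall h, (forall v, 0 <= h v) ->
      (forall w, (c w)%:Z - lap h w < (outdeg (val w))%:Z) ->
    forall v, g v <= h v].
Proof.
elim=> {c d} [c|c v d ucv _ [g [g0 dE gmin]]].
  by exists (fun=> 0); split=> // w; rewrite lap0 // subr0.
exists (g \+ single v); split=> [u|w|h h0 hs u]; first by rewrite addr_ge0.
  by rewrite dE fireE // lapD lap_single; lia.
(* A vector [h] that never fires [v] removes no chips from [v], which would stay unstable. *)
have hv : 0 < h v.
  rewrite lt_neqAle h0 andbT; apply/eqP => /esym hv0.
  suff : lap h v <= 0 by have := hs v; move: ucv; rewrite /unstable; lia.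
  exact: lap_le0.
suff /(_ u) : forall u, g u <= (h \- single v) u by rewrite /=; lia.
apply: gmin => [|w]; first exact: sub_single_ge0.
by rewrite fireE // lapB lap_single; have := hs w; lia.
Qed.

(** The vertex-wise form of [saturated]: no nonzero reverse firing [f] keeps all entries below the
    stability threshold. Entries of [c + lap f] may be negative. *)
Definition reduced_config c :=
  (forall v, (c v < outdeg (val v))%N) /\
  forall f, (forall v, 0 <= f v) ->
    (forall w, (c w)%:Z + lap f w < (outdeg (val w))%:Z) -> forall v, f v = 0.

Lemma add_configE c d v : (c + d) v = (c v + d v)%N.
Proof. by rewrite ffunE. Qed.

Lemma recurrent_reduced c : recurrent c -> reduced_config c.
Proof.
move=> [sc rc]; have cs v : (c v < outdeg (val v))%N.
  by rewrite ltnNge; exact: sc.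
split=> // f f0 fs.
(* All that is used is [a >= outdeg + lap f]. If firing [g] leads from [a + b] to [c], this makes
   [g - f] nonnegative; it also stabilizes [a + b], so leastness gives [g <= g - f]. *)
pose a : config Gam := [ffun w => absz ((outdeg (val w))%:Z + lap f w)%R].
have [b [/firing_sequence_least[g [g0 cE gmin]] _]] := rc a.
have gf0 v : 0 <= (g \- f) v.
  apply: lap_monotone => w; rewrite lapB; have := cE w; have := fs w.
  have := cs w; rewrite add_configE [a w]ffunE.
  by move: (outdeg _) (c w) (lap f w) => o cw lf; lia.
have gf : forall v, g v <= (g \- f) v.
  by apply: gmin => // w; rewrite lapB; have := cE w; have := fs w; lia.
by move=> v; have := gf v; have := f0 v; rewrite /=; lia.
Qed.

(** Any unstable vertex of [c] has [h v > 0], so firing it uses up one unit of [h]. Once no vertex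
    is unstable, reducedness of [d] forces the remaining [h] to be 0. *)
Lemma reduced_firing_sequence c d h : reduced_config d ->
  (forall v, 0 <= h v) -> (forall w, (c w)%:Z = (d w)%:Z + lap h w) ->
  firing_sequence c d.
Proof.
move=> [ds dr].
have [m] := ubnP (absz (\sum_v h v)%R); elim: m c h => // m IHm c h hm h0 cE.
have [/existsP[v ucv]|/existsPn sc] := boolP [exists v, unstable c v].
  have hv : 0 < h v.
    rewrite lt_neqAle h0 andbT; apply/eqP => /esym hv0.
    have := ds v; have := cE v; move: ucv; rewrite /unstable.
    by have := lap_le0 h0 hv0; lia.
  apply: (firing_cons ucv); apply: (IHm _ (h \- single v)) => [||w].
  - have -> : \sum_w (h \- single v) w = \sum_w h w - 1.
      rewrite sumrB; congr (_ - _); rewrite (bigD1 v) //= /single eqxx big1 //.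
      by move=> w /negPf ->.
    suff : 0 < \sum_w h w by lia.
    by rewrite (bigD1 v) //= ltr_wpDr // sumr_ge0.
  - exact: sub_single_ge0.
  by rewrite fireE // lapB lap_single; have := cE w; lia.
have hz : forall v, h v = 0.
  by apply: dr => // w; rewrite -cE; have := sc w; rewrite /unstable; lia.
suff -> : c = d by exact: firing_nil.
by apply/ffunP => w; have := cE w; rewrite lap0 // addr0 => -[].
Qed.

Lemma reduced_recurrent c : reduced_config c -> recurrent c.
Proof.
move=> rc; have [cs _] := rc; have sc : stable c.
  by move=> v; rewrite /unstable -ltnNge.
split=> // a.
have [h h0 hK] := lap_dominate (\sum_v a v)%N.
(* Since [lap h] dominates [a], the [absz] is harmless and [a + b = c + lap h]. *)
exists [ffun w => absz ((c w)%:Z + lap h w - (a w)%:Z)%R]; split=> //.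
apply: (reduced_firing_sequence rc h0) => w; rewrite add_configE ffunE.
have : (a w <= \sum_v a v)%N by rewrite (bigD1 w) //= leq_addr.
by have := hK w; lia.
Qed.

End Sandpile.

(** * Orbits *)

Section Symmetry.
Variables (Gam : sandpile_graph) (gT : finGroupType) (G : {group gT}).
Variable to : action G Gam.
Hypothesis Hact : sandpile_action to.
Implicit Types (v w : nonsink Gam) (c : config Gam).
Local Notation A := (sym_laplacian to).
Local Notation n := #|orbits to|.

Lemma mem_orbits v : nonsink_orbit to v \in orbits to.
Proof. exact: imset_f. Qed.

Definition orb v : 'I_n := enum_rank_in (mem_orbits v) (nonsink_orbit to v).

Lemma orbit_at_orb v : orbit_at (orb v) = nonsink_orbit to v.
Proof. by rewrite /orbit_at enum_rankK_in // mem_orbits. Qed.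

Lemma orbit_at_rep (j : 'I_n) : orbit_at j = nonsink_orbit to (orbit_rep j).
Proof. by apply/eqP; exact: (xchooseP (orbit_rep_subproof j)). Qed.

Lemma orb_eqP v w : reflect (exists2 g, g \in G & val w = to (val v) g)
                            (orb v == orb w).
Proof.
have E : (orb v == orb w) = (val w \in orbit to G (val v)).
  apply/eqP/orbit_in_eqP => //.
    move=> vw; have := orbit_at_orb w; rewrite -vw orbit_at_orb => /setP/(_ w).
    by rewrite !inE orbit_refl => /orbit_in_eqP ->.
  move=> wv; apply: enum_val_inj; rewrite -!/(orbit_at _) !orbit_at_orb.
  by apply/setP => u; rewrite !inE wv.
by rewrite E; apply: (iffP imsetP).
Qed.

Lemma orb_rep j : orb (orbit_rep j) = j.
Proof.
by apply: enum_val_inj; rewrite -!/(orbit_at _) orbit_at_orb orbit_at_rep.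
Qed.

Lemma mem_orbit_at v j : (v \in orbit_at j) = (orb v == j).
Proof.
rewrite orbit_at_rep -[in RHS](orb_rep j) eq_sym inE.
by apply/imsetP/orb_eqP => -[g gG E]; exists g.
Qed.

Lemma outdeg_orb v w : orb v = orb w -> outdeg (val v) = outdeg (val w).
Proof. by move/eqP/orb_eqP => [g gG ->]; rewrite outdeg_act. Qed.

(** Bridge to matrices: on firing vectors constant on orbits, the ordinary Laplacian acts as [A]. *)
Lemma lap_orb (x : 'cV[int]_n) w :
  lap (fun v => x (orb v) 0) w = (A *m x) (orb w) 0.
Proof.
rewrite mxE /lap (partition_big orb predT) //=; apply: eq_bigr => j _.
rewrite (sym_laplacianE Hact (orbit_at_rep j) (orbit_at_orb w)).
rewrite sum_ffunE mulr_suml; apply: eq_big => [v|v /eqP <-].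
  by rewrite -orbit_at_rep mem_orbit_at.
by rewrite mulrC.
Qed.

Lemma sym_laplacian_Zmatrix : Zmatrix A.
Proof.
move=> i j ij; rewrite mxE sum_ffunE sumr_le0 // => v.
rewrite mem_orbit_at => /eqP vj; apply: reduced_laplacian_le0.
by apply: contraNneq ij => E; rewrite -vj -E orb_rep.
Qed.

Lemma sym_laplacian_monotone : monotone_mx A.
Proof.
move=> x Ax i; have := @lap_monotone _ (fun v => x (orb v) 0) _ (orbit_rep i).
by rewrite orb_rep; apply=> w; rewrite lap_orb; exact: Ax.
Qed.

Lemma sym_laplacian_diag (i : 'I_n) : A i i <= (outdeg (val (orbit_rep i)))%:Z.
Proof.
rewrite mxE sum_ffunE (bigD1 (orbit_rep i)) /=; last first.
  by rewrite mem_orbit_at orb_rep.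
rewrite ffunE eqxx ler_wnDr ?lerBlDr ?lerDl //.
rewrite sumr_le0 // => v /andP[_ vi].
by rewrite reduced_laplacian_le0 // eq_sym.
Qed.

(** * Symmetric configurations as saturated vectors *)

Lemma act_configE c g v w : g \in G -> to (val v) g = val w ->
  act_config to c g w = c v.
Proof.
move=> gG vw; rewrite ffunE (big_pred1 v) // => u /=.
by rewrite -vw (inj_eq (act_inj to g)) ?val_eqE.
Qed.

Lemma symmetric_configP c :
  symmetric_config to c <-> forall v w, orb v = orb w -> c v = c w.
Proof.
split=> [sc v w /eqP/orb_eqP[g gG vw]|cc g gG].
  by rewrite -[in RHS](sc g gG) (act_configE _ gG (esym vw)).
apply/ffunP => w.
have uP : to (val w) g^-1%g != sink.
  by rewrite (nonsink_act Hact) ?groupV // (valP w).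
pose u : nonsink Gam := exist (fun x => x != sink) _ uP.
have uw : to (val u) g = val w by exact: actKVin.
rewrite (act_configE _ gG uw); apply: cc; apply/eqP/orb_eqP.
by exists g; rewrite ?uw.
Qed.

Definition orbit_max_stable : 'cV[int]_n :=
  \col_j ((outdeg (val (orbit_rep j)))%:Z - 1).

Lemma reduced_saturated c (u : 'cV_n) :
    (forall v, (c v)%:Z = u (orb v) 0) ->
  reduced_config c <-> saturated A orbit_max_stable u.
Proof.
move=> cu; have outE v : outdeg (val (orbit_rep (orb v))) = outdeg (val v).
  by apply: outdeg_orb; rewrite orb_rep.
split=> [[cs cr]|[us ur]].
  split=> [i|y y0 Hy].
    have := cu (orbit_rep i); rewrite orb_rep !mxE => <-.
    by have := cs (orbit_rep i); move: (outdeg _) (c _) => o k; lia.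
  have y_eq0 v : y (orb v) 0 = 0.
    apply: (cr (fun v => y (orb v) 0)) => // w; have := Hy (orb w).
    rewrite lap_orb cu; move: (A *m y) => Ay; rewrite !mxE outE.
    by move: (outdeg _) (u _ _) (Ay _ _) => o k l; lia.
  by apply/colP => j; rewrite mxE -(orb_rep j).
split=> [v|f f0 fs v].
  have := us (orb v); rewrite !mxE outE -cu.
  by move: (outdeg _) (c v) => o k; lia.
(* [m j] is a vertex of the orbit [j] where [f] is largest. There the orbitwise maximum [y] equals
   [f] and elsewhere it dominates [f], so its Laplacian at [m j] is at most that of [f]: [y]
   inherits feasibility. *)
pose m j := [arg max_(w > orbit_rep j | orb w == j) f w]%O.
have [mj mmax] : (forall j, orb (m j) = j) /\ (forall w, f w <= f (m (orb w))).
  split=> [j|w]; rewrite /m; case: Order.TotalTheory.arg_maxP => [|k /eqP];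
    by rewrite ?orb_rep //; move=> _; apply.
pose y : 'cV[int]_n := \col_j f (m j).
have y0 : y = 0.
  apply: ur => j; first by rewrite mxE.
  have := fs (m j); have : lap ((fun w => y (orb w) 0) \- f) (m j) <= 0.
    by apply: lap_le0 => [w|]; rewrite /= mxE ?mj ?subrr ?subr_ge0.
  rewrite lapB lap_orb -outE cu mj; move: (A *m y) => Ay.
  rewrite !mxE.
  by move: (outdeg _) (u _ _) (Ay _ _) (lap f _) => o k l l'; lia.
have := congr1 (fun M : 'cV_n => M (orb v) 0) y0; rewrite !mxE => my0.
by apply: le_anti; rewrite f0 -my0 mmax.
Qed.

Lemma symmetric_recurrentP c : symmetric_recurrent to c <->
  exists2 u, saturated A orbit_max_stable u & forall v, (c v)%:Z = u (orb v) 0.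
Proof.
split=> [[/recurrent_reduced rc /symmetric_configP sc]|[u su cu]].
  pose u : 'cV[int]_n := \col_j (c (orbit_rep j))%:Z.
  have cu v : (c v)%:Z = u (orb v) 0.
    by rewrite mxE (sc _ v) // orb_rep.
  by exists u => //; apply/(reduced_saturated cu).
split; first exact/reduced_recurrent/(reduced_saturated cu).
by apply/symmetric_configP => v w vw; have := cu v; rewrite vw -cu => -[].
Qed.

End Symmetry.

Theorem corollary2p11 (Gam : sandpile_graph) (gT : finGroupType)
    (G : {group gT}) (to : action G Gam)
    (Hact : sandpile_action to) :
  finite_set (symmetric_recurrent to) /\
  (#|` fset_set (symmetric_recurrent to)|%fset%:Z = \det (sym_laplacian to))%R.
Proof.
have ZA := @sym_laplacian_Zmatrix _ _ _ to.
have [T [r [cardT r_inj r_sat r_surj]]] :=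
  card_saturated (orbit_max_stable to) ZA (sym_laplacian_monotone Hact).
(* [absz] changes nothing here: saturated vectors are nonnegative, because a diagonal entry of the
   matrix is at most the out-degree on its orbit. *)
pose F t : config Gam := [ffun v => absz (r t (orb to v) 0%R)].
have FE t v : ((F t v)%:Z = r t (orb to v) 0)%R.
  rewrite ffunE gez0_abs //; apply: (saturated_ge0 ZA _ (r_sat t)) => i.
  by rewrite [orbit_max_stable _ _ _]mxE subrK sym_laplacian_diag.
have F_inj : injective F.
  move=> t t' Ftt'; apply: r_inj; apply/colP => j.
  by rewrite -(orb_rep j) -!FE Ftt'.
have -> : symmetric_recurrent to = [set` [fset F t | t in T]%fset]%classic.
  apply/seteqP; split=> c /=.
    move/(symmetric_recurrentP Hact) => [u /r_surj[t ->] cu].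
    apply/imfsetP; exists t => //; apply/ffunP => v.
    by have := cu v; rewrite -FE => -[].
  move=> /imfsetP[t _ ->]; apply/(symmetric_recurrentP Hact).
  by exists (r t).
by split; [exact: finite_fset | rewrite set_fsetK card_imfset // -cardE].
Qed.
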